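(* Let $\pi:\mathrm{SU}(2)\to \mathrm{SO}(3)$ be the standard $2$-to-$1$ surjective group homomorphism, let $G$ be a finite subgroup of $\mathrm{SU}(2)$ of even order (so $-1\in G$), and let $V_1,\dots,V_r$ be a full list of pairwise non-isomorphic irreducible complex representations of $G$. Let $\mathfrak{V}$ be the set of those $V_i$ that come from a representation of $\pi(G)$, i.e. that factor through the natural map $G\to\pi(G)$ (equivalently, $-1$ acts trivially on $V_i$), and let $\mathfrak{V}'$ be the set of the remaining $V_i$. Then the Mckay diagram of $G$ is bipartite with parts $\mathfrak{V}$ and $\mathfrak{V}'$: whenever $V_i$ and $V_j$ are joined by an edge, exactly one of them belongs to $\mathfrak{V}$ and the other belongs to $\mathfrak{V}'$.
   Context: The kernel of $\pi$ is $\{\pm 1\}$. Let $W=\mathbb{C}^2$ be the natural two-dimensional representation of $G\subseteq \mathrm{SU}(2)$. The Mckay diagram of $G$ (with respect to $W$) is the undirected multigraph with vertices $V_1,\dots,V_r$ in which $V_i$ and $V_j$ are joined by $n_{ij}=\dim_{\mathbb{C}}\mathrm{Hom}_G(V_i,W\otimes V_j)$ edges (one has $n_{ij}=n_{ji}$ since $W$ is self-dual). *)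

(* Defs.v *)
From HB Require Import structures.
From mathcomp Require Import all_boot all_order all_algebra all_fingroup.
From mathcomp Require Import all_solvable all_field all_character.
From mathcomp Require Import finmap reals complex ring lra.

Set Implicit Arguments.
Unset Strict Implicit.
Unset Printing Implicit Defensive.

Import Order.TTheory GRing.Theory Num.Theory.
Local Open Scope ring_scope.
Local Open Scope sesquilinear_scope.

Section SpecialUnitary.
Variables (R : realType) (n : nat).

Definition special_unitary : pred 'M[R[i]]_n :=
  fun U => (U \is unitarymx) && (\det U == 1).

Record SU := MkSU { SU_val :> 'M[R[i]]_n; _ : special_unitary SU_val }.
HB.instance Definition _ := [isSub for SU_val].
HB.instance Definition _ := [Choice of SU by <:].

Fact SU_one_subproof : special_unitary 1%:M.
Proof.
apply/andP; split; last by rewrite det1.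
by apply/unitarymxP; rewrite trmx1 map_mx1 mulmx1.
Qed.

Fact SU_mul_subproof (U V : SU) : special_unitary (U *m V).
Proof.
case: U V => [U /andP[hU /eqP dU]] [V /andP[hV /eqP dV]] /=.
apply/andP; split; first exact: (mul_unitarymx hU hV).
by rewrite det_mulmx dU dV mulr1.
Qed.

Fact SU_inv_subproof (U : SU) : special_unitary ((U : 'M_n) ^t*).
Proof.
case: U => [U /andP[hU /eqP dU]] /=; apply/andP.
by rewrite trmxC_unitary hU det_map_mx det_tr dU rmorph1.
Qed.

Definition SU_one : SU := MkSU SU_one_subproof.
Definition SU_mul (U V : SU) : SU := MkSU (SU_mul_subproof U V).
Definition SU_inv (U : SU) : SU := MkSU (SU_inv_subproof U).

Fact SU_mulA : associative SU_mul.
Proof. by move=> U V W; apply: val_inj; rewrite /= mulmxA. Qed.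
Fact SU_mul1g : left_id SU_one SU_mul.
Proof. by move=> U; apply: val_inj; rewrite /= mul1mx. Qed.
Fact SU_mulg1 : right_id SU_one SU_mul.
Proof. by move=> U; apply: val_inj; rewrite /= mulmx1. Qed.
Fact SU_mulgV : right_inverse SU_one SU_inv SU_mul.
Proof. by case=> [U hU]; apply: val_inj; case/andP: (hU) => /unitarymxP. Qed.
Fact SU_mulVg : left_inverse SU_one SU_inv SU_mul.
Proof.
by move=> U; apply: val_inj; apply: mulmx1C; exact: (congr1 val (SU_mulgV U)).
Qed.

HB.instance Definition _ :=
  isGroup.Build SU SU_mulA SU_mul1g SU_mulg1 SU_mulVg SU_mulgV.

End SpecialUnitary.

Section SpecialOrthogonal.
Variables (R : realType) (n : nat).

Definition special_orthogonal : pred 'M[R]_n :=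
  fun A => (A *m A^T == 1%:M) && (\det A == 1).

Record SO := MkSO { SO_val :> 'M[R]_n; _ : special_orthogonal SO_val }.
HB.instance Definition _ := [isSub for SO_val].
HB.instance Definition _ := [Choice of SO by <:].

Fact SO_one_subproof : special_orthogonal 1%:M.
Proof. by rewrite /special_orthogonal trmx1 mulmx1 det1 !eqxx. Qed.

Fact SO_mul_subproof (A B : SO) : special_orthogonal (A *m B).
Proof.
case: A B => [A /andP[/eqP hA /eqP dA]] [B /andP[/eqP hB /eqP dB]] /=.
apply/andP; rewrite det_mulmx dA dB mulr1 trmx_mul mulmxA.
by rewrite -(mulmxA A) hB mulmx1 hA !eqxx.
Qed.

Fact SO_inv_subproof (A : SO) : special_orthogonal (A : 'M_n)^T.
Proof.
case: A => [A /andP[/eqP hA /eqP dA]] /=; apply/andP.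
by rewrite trmxK (mulmx1C hA) det_tr dA !eqxx.
Qed.

Definition SO_one : SO := MkSO SO_one_subproof.
Definition SO_mul (A B : SO) : SO := MkSO (SO_mul_subproof A B).
Definition SO_inv (A : SO) : SO := MkSO (SO_inv_subproof A).

Fact SO_mulA : associative SO_mul.
Proof. by move=> A B D; apply: val_inj; rewrite /= mulmxA. Qed.
Fact SO_mul1g : left_id SO_one SO_mul.
Proof. by move=> A; apply: val_inj; rewrite /= mul1mx. Qed.
Fact SO_mulg1 : right_id SO_one SO_mul.
Proof. by move=> A; apply: val_inj; rewrite /= mulmx1. Qed.
Fact SO_mulgV : right_inverse SO_one SO_inv SO_mul.
Proof. by case=> [A hA]; apply: val_inj; case/andP: (hA) => /eqP. Qed.
Fact SO_mulVg : left_inverse SO_one SO_inv SO_mul.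
Proof.
by move=> A; apply: val_inj; apply: mulmx1C; exact: (congr1 val (SO_mulgV A)).
Qed.

HB.instance Definition _ :=
  isGroup.Build SO SO_mulA SO_mul1g SO_mulg1 SO_mulVg SO_mulgV.

End SpecialOrthogonal.

Section CoveringMap.
Variable R : realType.
Local Notation C := R[i].

Definition mx22 (a b c d : C) : 'M[C]_2 :=
  \matrix_(i, j) tnth (tnth [tuple [tuple a; b]; [tuple c; d]] i) j.

Definition pauli : 3.-tuple 'M[C]_2 :=
  [tuple mx22 0 1 1 0; mx22 0 (- 'i%C) 'i%C 0; mx22 1 0 0 (- 1)].

(* The standard covering SU(2) -> SO(3): the conjugation action of U on the
   traceless Hermitian matrices, U s_j U^* = \sum_i (covering_mx U)_ij s_i, in
   the basis of Pauli matrices s_1, s_2, s_3, which is orthogonal for the real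
   inner product (A, B) |-> tr (A B) / 2. *)
Definition covering_mx (U : 'M[C]_2) : 'M[R]_3 :=
  \matrix_(i, j)
    (complex.Re (\tr (tnth pauli i *m (U *m tnth pauli j *m U^t*))) / 2).

Lemma mx22_mul a b c d a' b' c' d' :
  mx22 a b c d *m mx22 a' b' c' d' =
  mx22 (a * a' + b * c') (a * b' + b * d') (c * a' + d * c') (c * b' + d * d').
Proof.
apply/matrixP=> i j; rewrite !mxE big_ord_recr big_ord1 /= !mxE.
by case: i => [[|[|//]] hi]; case: j => [[|[|//]] hj].
Qed.

Lemma mx22_adj a b c d : (mx22 a b c d) ^t* = mx22 a^* c^* b^* d^*.
Proof.
apply/matrixP=> i j; rewrite !mxE.
by case: i => [[|[|//]] hi]; case: j => [[|[|//]] hj].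
Qed.

Lemma mx22_tr a b c d : \tr (mx22 a b c d) = a + d.
Proof. by rewrite /mxtrace big_ord_recr big_ord1 /= !mxE. Qed.

Lemma mx22P (U : 'M[C]_2) : U = mx22 (U 0 0) (U 0 1) (U 1 0) (U 1 1).
Proof.
apply/matrixP=> i j; rewrite !mxE.
by case: i => [[|[|//]] hi]; case: j => [[|[|//]] hj]; congr (U _ _);
  apply: val_inj.
Qed.

Lemma mx22_det a b c d : \det (mx22 a b c d) = a * d - b * c.
Proof.
rewrite (expand_det_row _ 0) big_ord_recr big_ord1 /cofactor /= !det_mx11.
by rewrite !mxE !(tnth_nth 0) /= /bump /= expr0 expr1; ring.
Qed.

Lemma SU2P (U : SU R 2) :
  exists x y z w : R, x ^+ 2 + y ^+ 2 + z ^+ 2 + w ^+ 2 = 1 /\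
    U = mx22 (x +i* y)%C (z +i* w)%C (- z +i* w)%C (x -i* y)%C :> 'M_2.
Proof.
case: U => U /= /andP[/unitarymxP UU /eqP].
move: UU; rewrite [U]mx22P mx22_det.
move: (U 0 0) (U 0 1) (U 1 0) (U 1 1) => a b c d UU det.
have adj : (mx22 a b c d) ^t* = mx22 d (- b) (- c) a.
  rewrite -[LHS]mul1mx.
  have <- : mx22 d (- b) (- c) a *m mx22 a b c d = 1%:M.
    rewrite mx22_mul; apply/matrixP=> i j; rewrite !mxE.
    by case: i => [[|[|//]] hi]; case: j => [[|[|//]] hj] //=;
      rewrite /tnth /= -?det; ring.
  by rewrite -mulmxA UU mulmx1.
move: adj; rewrite mx22_adj => /matrixP adj.
have := adj 0 0; have := adj 1 0; rewrite !mxE !(tnth_nth 0) /= => {adj UU}.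
case: a b c d det => [x y] [z w] [c1 c2] [d1 d2] det [bE1 bE2] [aE1 aE2].
have {bE1}c1E : c1 = - z by rewrite bE1 opprK.
have {bE2}c2E : c2 = w by apply: oppr_inj; rewrite -bE2.
subst c1 c2 d1 d2; case: det => det _; exists x, y, z, w; split=> //.
by rewrite -det; ring.
Qed.

Definition quat_mx (x y z w : R) : 'M[R]_3 :=
  \matrix_(i, j) tnth (tnth [tuple
    [tuple x ^+ 2 - y ^+ 2 - z ^+ 2 + w ^+ 2; 2 * (x * y + z * w);
           2 * (y * w - x * z)];
    [tuple 2 * (z * w - x * y); x ^+ 2 - y ^+ 2 + z ^+ 2 - w ^+ 2;
           2 * (x * w + y * z)];
    [tuple 2 * (x * z + y * w); 2 * (y * z - x * w);
           x ^+ 2 + y ^+ 2 - z ^+ 2 - w ^+ 2]] i) j.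

Lemma covering_mxE x y z w :
  covering_mx (mx22 (x +i* y)%C (z +i* w)%C (- z +i* w)%C (x -i* y)%C)
  = quat_mx x y z w.
Proof.
apply/matrixP=> i j; rewrite !mxE mx22_adj.
case: i => [[|[|[|//]]] hi]; case: j => [[|[|[|//]]] hj];
  rewrite !(tnth_nth 0) /= !mx22_mul mx22_tr /=; by field.
Qed.

Fact covering_subproof (U : SU R 2) : special_orthogonal (covering_mx U).
Proof.
have [x [y [z [w [N ->]]]]] := SU2P U; rewrite covering_mxE.
apply/andP; split; apply/eqP.
  have -> : 1%:M = ((x ^+ 2 + y ^+ 2 + z ^+ 2 + w ^+ 2) ^+ 2)%:M :> 'M[R]_3.
    by rewrite N expr1n.
  apply/matrixP=> i j; rewrite !mxE !big_ord_recr big_ord0 /= !mxE.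
  by case: i => [[|[|[|//]]] hi]; case: j => [[|[|[|//]]] hj];
    rewrite !(tnth_nth 0) /=; ring.
have -> : 1 = (x ^+ 2 + y ^+ 2 + z ^+ 2 + w ^+ 2) ^+ 3 by rewrite N expr1n.
rewrite (expand_det_row _ 0) !big_ord_recr big_ord0 /cofactor /=.
rewrite !(expand_det_row _ 0) !big_ord_recr !big_ord0 /cofactor /= !det_mx11.
rewrite !mxE !(tnth_nth 0) /= /bump /= !(expr0, expr1, sqrrN, expr1n, mul1r).
by ring.
Qed.

Definition covering (U : SU R 2) : SO R 3 := MkSO (covering_subproof U).

Fact covering_mul_subproof : {morph covering : U V / (U * V)%g}.
Proof.
move=> U V; apply: val_inj => /=.
have [x [y [z [w [_ ->]]]]] := SU2P U; have [a [b [c [d [_ ->]]]]] := SU2P V.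
pose X := x * a - y * b - z * c - w * d.
pose Y := x * b + y * a + z * d - w * c.
pose Z := x * c - y * d + z * a + w * b.
pose W := x * d + y * c - z * b + w * a.
rewrite mx22_mul.
have -> : ((x +i* y) * (a +i* b) + (z +i* w) * (- c +i* d) = X +i* Y)%C.
  by simpc; congr (_ +i* _)%C; rewrite /X /Y; ring.
have -> : ((x +i* y) * (c +i* d) + (z +i* w) * (a -i* b) = Z +i* W)%C.
  by simpc; congr (_ +i* _)%C; rewrite /Z /W; ring.
have -> : ((- z +i* w) * (a +i* b) + (x -i* y) * (- c +i* d) = - Z +i* W)%C.
  by simpc; congr (_ +i* _)%C; rewrite /Z /W; ring.
have -> : ((- z +i* w) * (c +i* d) + (x -i* y) * (a -i* b) = X -i* Y)%C.
  by simpc; congr (_ +i* _)%C; rewrite /X /Y; ring.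
rewrite !covering_mxE; apply/matrixP=> i j.
rewrite !mxE !big_ord_recr big_ord0 /= !mxE.
by case: i => [[|[|[|//]]] hi]; case: j => [[|[|[|//]]] hj];
  rewrite !(tnth_nth 0) /= /X /Y /Z /W; ring.
Qed.

Lemma covering_eq1 (U : SU R 2) :
  (covering U == 1%g) = ((U : 'M_2) == 1%:M) || ((U : 'M_2) == - 1%:M).
Proof.
have [x [y [z [w [N UE]]]]] := SU2P U.
apply/eqP/orP => [/(congr1 val) /= | U1].
  rewrite UE covering_mxE => /matrixP E.
  have := E 0 0; have := E 1 1; have := E ord_max ord_max.
  rewrite !mxE !(tnth_nth 0) /= => e2 e1 e0.
  have y0 : y = 0 by apply/eqP; rewrite -sqrf_eq0; apply/eqP; lra.
  have z0 : z = 0 by apply/eqP; rewrite -sqrf_eq0; apply/eqP; lra.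
  have w0 : w = 0 by apply/eqP; rewrite -sqrf_eq0; apply/eqP; lra.
  have /eqP : x ^+ 2 = 1 by lra.
  rewrite sqrf_eq1 y0 z0 w0 !oppr0 => /orP[] /eqP->; [left | right];
    apply/eqP/matrixP=> i j; rewrite !mxE;
    by case: i => [[|[|//]] hi]; case: j => [[|[|//]] hj];
      rewrite !(tnth_nth 0) /=; simpc.
have [x1 y0 z0 w0] : [/\ x ^+ 2 = 1, y = 0, z = 0 & w = 0].
  case: U1; rewrite UE => /eqP/matrixP E; have := E 0 0; have := E 0 1;
    rewrite !mxE !(tnth_nth 0) /=; simpc => -[-> ->] -[-> ->];
    by rewrite ?oppr0 ?sqrrN expr1n.
apply: val_inj; rewrite /= UE covering_mxE y0 z0 w0.
apply/matrixP=> i j; rewrite !mxE.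
by case: i => [[|[|[|//]]] hi]; case: j => [[|[|[|//]]] hj];
  rewrite !(tnth_nth 0) /= ?x1; ring.
Qed.
Fact covering_one_subproof : covering (1%g : SU R 2) = 1%g.
Proof. by apply/eqP; rewrite covering_eq1 eqxx. Qed.
End CoveringMap.

HB.instance Definition _ (R : realType) :=
  isUMagmaMorphism.Build (SU R 2) (SO R 3) (@covering R)
    (conj (@covering_one_subproof R) (@covering_mul_subproof R)).

Section FiniteSubgroup.
Variable T : groupType.

Record finSubgroup := FinSubgroup {
  fsg_set :> {fset T};
  _ : group_closed (mem fsg_set) }.

Fact fsg_closed (G : finSubgroup) : group_closed (mem (fsg_set G)).
Proof. by case: G. Qed.

(* The elements of G, as a finite group in its own right, so that the theory of
   finite group representations applies to [set: elt G]. *)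
Definition elt (G : finSubgroup) : Type := fset_sub_type (fsg_set G).

HB.instance Definition _ (G : finSubgroup) := Finite.on (elt G).
HB.instance Definition _ (G : finSubgroup) := SubChoice.on (elt G).
HB.instance Definition _ (G : finSubgroup) :=
  SubChoice_isSubGroup.Build T (mem (fsg_set G)) (elt G) (@fsg_closed G).
End FiniteSubgroup.

Section Image.
Variables (T T' : groupType) (f : UMagmaMorphism.type T T').
Variable G : finSubgroup T.

Fact image_closed : group_closed (mem [fset f x | x in fsg_set G]%fset).
Proof.
have [G1 GF] := fsg_closed G; split=> [|_ _ /imfsetP[x Gx ->] /imfsetP[y Gy ->]].
  by apply/imfsetP; exists 1%g; rewrite ?gmulf1.
by apply/imfsetP; exists (x * y^-1)%g; rewrite ?gmulfF //; apply: GF.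
Qed.

Definition image_fsg : finSubgroup T' := FinSubgroup image_closed.

Fact elt_image_subproof (g : elt G) : f (val g) \in fsg_set image_fsg.
Proof. by apply/imfsetP; exists (val g) => //; exact: valP. Qed.

Definition elt_image (g : elt G) : elt image_fsg := FSetSub (elt_image_subproof g).
End Image.

Section HomSpace.
Variables (F : fieldType) (gT : finGroupType) (G : {group gT}) (m n : nat).
Variables (U : mx_representation F G m) (V : mx_representation F G n).

(* Mathcomp matrix representations act on row vectors, so a linear map U -> V is
   a matrix B acting as u |-> u *m B; compare mx_rsim. *)
Definition hom_space : {vspace 'M[F]_(m, n)} :=
  (\bigcap_(g in G) lker (linfun (mulmx (U g)) - linfun (mulmxr (V g))))%VS.

Lemma hom_spaceP (B : 'M[F]_(m, n)) :
  reflect {in G, forall g, U g *m B = B *m V g} (B \in hom_space).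
Proof.
rewrite memvE; apply: (iffP subv_bigcapP) => H g Gg; have := H g Gg.
  by rewrite -memvE memv_ker add_lfunE opp_lfunE !lfunE /= subr_eq0 => /eqP.
by move=> e; rewrite -memvE memv_ker add_lfunE opp_lfunE !lfunE /= subr_eq0 e.
Qed.
End HomSpace.

Section McKay.
Variables (R : realType) (G : finSubgroup (SU R 2)).
Local Notation C := R[i].

Fact natural_mx_repr :
  mx_repr [set: elt G] (fun g => val (val g) : 'M[C]_2).
Proof. by []. Qed.

Definition natural_repr : mx_representation C [set: elt G] 2 :=
  MxRepresentation natural_mx_repr.

(* The number of edges joining i and j: dim Hom_G (V_i, W (x) V_j), where W is
   the natural representation. *)
Definition mckay (I : Type) (V : I -> representation C [set: elt G]) (i j : I) :
    nat :=
  \dim (hom_space (V i) (prod_repr natural_repr (V j))).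

Definition from_covering (V : representation C [set: elt G]) : Prop :=
  exists V' : mx_representation C [set: elt (image_fsg (@covering R) G)]
                                (rdegree V),
    forall g : elt G, V g = V' (elt_image (@covering R) g).

End McKay.

Definition bipartite (I : Type) (edges : I -> I -> nat) (A B : I -> Prop) :=
  [/\ forall i, A i \/ B i,
      forall i, ~ (A i /\ B i)
    & forall i j, (0 < edges i j)%N -> A i /\ B j \/ B i /\ A j].

(* Main.v *)
Require Import Defs.
From mathcomp Require Import all_boot all_order all_algebra all_fingroup.
From mathcomp Require Import all_solvable all_field all_character.
From mathcomp Require Import finmap reals complex.
From mathcomp Require Import lra.

(** The element -1 of G decides everything. A group of even order contains an
    involution, by Cauchy's theorem, and the only involution of SU(2) is -1
    ([SU2_involution]); so -1 lies in G, and it is central there. By Schur's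
    lemma it acts on an irreducible representation as 1 or as -1
    ([irr_central_involution]). It acts as 1 exactly on the representations
    that factor through the covering, because the kernel of the covering is
    {1, -1} ([from_coveringP]).

    On the natural representation W it acts as -1, so on the tensor product of
    W with V_j it acts by the opposite of the sign by which it acts on V_j. A
    nonzero homomorphism from V_i to this tensor product commutes with -1, hence
    forces the sign of V_i to be that opposite sign ([hom_space_central_eq]):
    adjacent vertices have opposite signs. *)

Set Implicit Arguments.
Unset Strict Implicit.
Unset Printing Implicit Defensive.

Local Open Scope ring_scope.

Import Order.TTheory GRing.Theory Num.Theory.

Lemma tprod_scale (F : fieldType) (m1 n1 m2 n2 : nat) (a b : F)
    (A : 'M[F]_(m1, n1)) (B : 'M[F]_(m2, n2)) :
  tprod (a *: A) (b *: B) = (a * b) *: tprod A B.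
Proof.
elim: m1 n1 A => [|m1 IH] n1 A /=; first by rewrite scaler0.
rewrite !linearZ /= IH -trowbE linearZ /= trowbE scale_col_mx scalerA.
by rewrite [b * a]mulrC.
Qed.

Lemma tprod_scalar (F : fieldType) (m n : nat) (a b : F) :
  tprod (a%:M : 'M[F]_m) (b%:M : 'M[F]_n) = (a * b)%:M.
Proof. by rewrite -[a%:M]scalemx1 -[b%:M]scalemx1 tprod_scale tprod1 scalemx1. Qed.

(** Schur's lemma applied to rG z - 1, which is killed by rG z + 1: if it is not
    zero then it is invertible and rG z + 1 vanishes, so z acts by a sign
    over any base field. *)
Lemma irr_central_involution (F : fieldType) (gT : finGroupType)
    (G : {group gT}) (n : nat) (rG : mx_representation F G n) (z : gT) :
  mx_irreducible rG -> z \in 'Z(G)%g -> (z * z = 1)%g ->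
  rG z = 1%:M \/ rG z = (- 1)%:M.
Proof.
move=> irrG /centerP[Gz cGz] zz.
have cent : centgmx rG (rG z - 1%:M).
  apply/centgmxP=> x Gx.
  by rewrite mulmxBl mulmxBr mulmx1 mul1mx -!repr_mxM // cGz.
case: (eqVneq (rG z - 1%:M) 0) => [/eqP | /(mx_Schur irrG cent) unit_z].
  by rewrite subr_eq0 => /eqP; left.
right; apply/eqP; rewrite -subr_eq0 raddfN opprK; apply/eqP.
rewrite -[LHS](mulKmx unit_z) mulmxDr mulmx1 mulmxBl mul1mx -repr_mxM // zz.
by rewrite repr_mx1 subrKA subrr mulmx0.
Qed.

(** A homomorphism B that intertwines the two actions of z satisfies
    a *: B = b *: B. *)
Lemma hom_space_central_eq (F : fieldType) (gT : finGroupType) (G : {group gT})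
    (m n : nat) (U : mx_representation F G m) (V : mx_representation F G n)
    (z : gT) (a b : F) :
  z \in G -> U z = a%:M -> V z = b%:M -> (0 < \dim (hom_space U V))%N -> a = b.
Proof.
move=> Gz Uz Vz; rewrite lt0n dimv_eq0 -vpick0.
set B := vpick _ => nzB.
have /hom_spaceP/(_ z Gz) : B \in hom_space U V by exact: memv_pick.
rewrite Uz Vz mul_scalar_mx mul_mx_scalar => /eqP.
by rewrite -subr_eq0 -scalerBl scaler_eq0 (negPf nzB) orbF subr_eq0 => /eqP.
Qed.

(** The quotient representation sends f g to rG g; this does not depend on g
    because two elements with the same image differ by an element of the
    kernel. *)
Lemma repr_descend (F : fieldType) (gT hT : finGroupType) (f : gT -> hT)
    (n : nat) (rG : mx_representation F [set: gT] n) :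
  {morph f : x y / (x * y)%g} -> (forall h, exists g, f g = h) ->
  (forall g, f g = 1%g -> rG g = 1%:M) ->
  exists rH : mx_representation F [set: hT] n, forall g, rG g = rH (f g).
Proof.
move=> fM f_surj ker_f.
pose lift h := odflt 1%g [pick g | f g == h].
have liftK h : f (lift h) = h.
  rewrite /lift; case: pickP => [g /eqP // | no_g].
  by have [g fg] := f_surj h; have := no_g g; rewrite fg eqxx.
have f1 : f 1%g = 1%g by apply: (mulgI (f 1%g)); rewrite -fM !mulg1.
have rGf x y : f x = f y -> rG x = rG y.
  move=> fxy; rewrite -[x in LHS](mulgKV y) repr_mxM ?inE //.
  by rewrite (ker_f (x * y^-1)%g) ?mul1mx // fM fxy -fM mulgV.
have rH : mx_repr [set: hT] (fun h => rG (lift h)).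
  split=> [|x y _ _]; first by rewrite -(repr_mx1 rG); apply: rGf; rewrite liftK f1.
  by rewrite -repr_mxM ?inE //; apply: rGf; rewrite fM !liftK.
by exists (MxRepresentation rH) => g /=; apply: rGf; rewrite liftK.
Qed.

(** An involution of SU(2) equals its inverse, that is its adjoint; in the
    quaternion coordinates of [SU2P] this kills the imaginary part, and a real
    unit quaternion is 1 or -1. *)
Lemma SU2_involution (R : realType) (U : SU R 2) :
  (U * U = 1)%g -> U != 1%g -> (U : 'M_2) = - 1%:M.
Proof.
move=> UU nt_U; have [x [y [z [w [N UE]]]]] := SU2P U.
have UV : SU_val U = (U^-1)%g.
  by rewrite -[in LHS](mulg1 U) -(mulgV U) mulgA UU mul1g.
move: UV; rewrite /= {1 2}UE mx22_adj => /matrixP E.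
have := E 0 0; have := E 0 1; rewrite !mxE !(tnth_nth 0) /=.
move=> [z0 w0] [y0].
have {}y0 : y = 0 by lra.
have {}z0 : z = 0 by lra.
have {}w0 : w = 0 by lra.
rewrite y0 z0 w0 expr0n /= !addr0 in N UE.
have {}UE : SU_val U = (x%:C%C)%:M.
  rewrite UE !oppr0; apply/matrixP=> i j; rewrite !mxE !(tnth_nth 0).
  by case: i => [[|[|//]] hi]; case: j => [[|[|//]] hj].
move/eqP: N; rewrite sqrf_eq1 => /orP[] /eqP x1; rewrite UE x1.
  by case/eqP: nt_U; apply: val_inj; rewrite /= UE x1.
by rewrite !raddfN.
Qed.

Lemma exists_minus_one (R : realType) (G : finSubgroup (SU R 2)) :
  ~~ odd #|[set: elt G]| -> exists z : elt G, (val z : 'M_2) = - 1%:M.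
Proof.
rewrite -dvdn2 => even_G.
have [z _ ord_z] := Cauchy (G := [set: elt G]) (isT : prime 2) even_G.
have zz : (z * z = 1)%g by have := expg_order z; rewrite ord_z.
exists z; apply: SU2_involution; first exact: (congr1 val zz).
by apply/eqP=> z1; move: ord_z; rewrite (_ : z = 1%g) ?order1 //; apply: val_inj.
Qed.

Lemma elt_image_surj (T T' : groupType) (f : UMagmaMorphism.type T T')
    (G : finSubgroup T) (h : elt (image_fsg f G)) :
  exists g : elt G, elt_image f g = h.
Proof.
have /imfsetP[x Gx hE] : val h \in fsg_set (image_fsg f G) by exact: valP.
by exists (FSetSub Gx); apply: val_inj.
Qed.

Lemma elt_imageM (T T' : groupType) (f : UMagmaMorphism.type T T')
    (G : finSubgroup T) :
  {morph @elt_image T T' f G : x y / (x * y)%g}.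
Proof. by move=> x y; apply: val_inj; rewrite /= gmulfM. Qed.

Section MinusOne.
Variables (R : realType) (G : finSubgroup (SU R 2)) (z : elt G).
Hypothesis zE : (val z : 'M_2) = - 1%:M.

Lemma elt_image_eq1 (g : elt G) :
  elt_image (@covering R) g = 1%g <-> g = 1%g \/ g = z.
Proof.
have -> : elt_image (@covering R) g = 1%g <-> covering (val g) = 1%g.
  by split=> [/(congr1 val) | g1]; last exact: val_inj.
split=> [/eqP | g1].
  rewrite covering_eq1 => /orP[] /eqP gE; [left | right]; do 2!apply: val_inj;
  by rewrite /= gE ?zE.
by apply/eqP; rewrite covering_eq1; case: g1 => ->; rewrite ?zE eqxx ?orbT.
Qed.

Lemma minus_one_central : z \in 'Z([set: elt G])%g.
Proof.
apply/centerP; split=> [|g _]; first by rewrite inE.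
by do 2!apply: val_inj; rewrite /= zE mulmxN mulNmx mulmx1 mul1mx.
Qed.

Lemma minus_one_sqr : (z * z = 1)%g.
Proof. by do 2!apply: val_inj; rewrite /= zE mulmxN mulmx1 opprK. Qed.

(** Only the kernel {1, z} of the covering matters: a representation that is
    trivial on it descends to the image. *)
Lemma from_coveringP (V : representation R[i] [set: elt G]) :
  from_covering V <-> V z = 1%:M.
Proof.
split=> [[V' VE] | Vz].
  by rewrite VE (_ : elt_image _ z = 1%g) ?repr_mx1 //; apply/elt_image_eq1; right.
apply: repr_descend => [x y | h | g /elt_image_eq1[] -> //].
- exact: elt_imageM.
- exact: elt_image_surj.
- exact: repr_mx1.
Qed.

End MinusOne.

Theorem theorem2 (R : realType) (G : finSubgroup (SU R 2))
    (G_even : ~~ odd #|[set: elt G]|)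
    (r : nat) (V : 'I_r -> representation R[i] [set: elt G])
    (V_irr : forall i, mx_irreducible (V i))
    (V_noniso : forall i j, i != j -> ~ mx_rsim (V i) (V j))
    (V_full : forall U : representation R[i] [set: elt G],
       mx_irreducible U -> exists i, mx_rsim U (V i)) :
  bipartite (mckay V) (fun i => from_covering (V i))
                      (fun i => ~ from_covering (V i)).
Proof.
have [z zE] := exists_minus_one G_even.
have fromP i := from_coveringP zE (V i).
(* Equality of matrices over R[i] is decidable, hence so is descent. *)
have fromVN i : from_covering (V i) \/ ~ from_covering (V i).
  by case: (V i z =P 1%:M) => Viz; [left | right]; rewrite fromP.
have sign i : V i z = 1%:M \/ V i z = (- 1)%:M.
  exact: irr_central_involution (V_irr i) (minus_one_central zE) (minus_one_sqr zE).
split=> [// | i [] // | i j edge_ij].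
have Wz : natural_repr G z = (- 1)%:M by rewrite /= zE raddfN.
have tensor_z b : V j z = b%:M ->
    prod_repr (natural_repr G) (V j) z = (- 1 * b)%:M.
  by move=> Vjz; rewrite -tprod_scalar -Wz -Vjz.
have opposite a b : V i z = a%:M -> V j z = b%:M -> a = - 1 * b.
  move=> Viz /tensor_z WVz.
  exact: hom_space_central_eq (in_setT z) Viz WVz edge_ij.
(* If both or neither descend, the signs agree and [opposite] gives 1 = -1. *)
case: (fromVN i) (fromVN j) => [Vi | Vi] [Vj | Vj]; [| by left | by right |].
  have /eqP := opposite _ _ ((fromP i).1 Vi) ((fromP j).1 Vj).
  by rewrite mulr1 eq_sym eqNr oner_eq0.
have signN k : ~ from_covering (V k) -> V k z = (- 1)%:M.
  by case: (sign k) => // Vkz []; apply/fromP.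
have /eqP := opposite _ _ (signN i Vi) (signN j Vj).
by rewrite mulN1r eq_sym eqNr oppr_eq0 oner_eq0.
Qed.
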